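(* Let $n,k$ be positive integers with $2\le k\le n-2$ and let $\alpha$ be a positive integer. Then $Q^*(C_n^k,\alpha\mathbf{1})$ is equal to the set of points $x\in\mathbb{R}^n$ satisfying $C_n^kx\ge\alpha\mathbf{1}$, $x\ge0$, the rank constraint $\sum_{j=1}^n x_j\ge\tau_{\alpha\mathbf{1}}(C_n^k)$, and the $\Gamma$-inequalities (with respect to $b=\alpha\mathbf{1}$) for the circuits $\Gamma$ of $F(C_n^k)$ containing no forward short arcs (and with $p(\Gamma)\ne 0$, so that the inequality is defined).
   Context: Notation: $[n]=\{1,\dots,n\}$ with addition mod $n$ (index $0$ identified with $n$); for $a,c\in[n]$ with $t\ge0$ minimal such that $a+t\equiv c\pmod n$, $[a,c)_n=\{a,\dots,a+t-1\}$ (mod $n$). $C_n^k$ is the $n\times n$ $\{0,1\}$-matrix whose row $i$ is the incidence vector of $[i,i+k)_n$. For a matrix $A$ and $b\in\mathbb{Z}_+^m$: $Q(A,b)=\{x\ge0:Ax\ge b\}$, $Q^*(A,b)=\operatorname{conv}(Q(A,b)\cap\mathbb{Z}^n)$, $\tau_b(A)=\min\{\mathbf{1}^Tx:x\in Q^*(A,b)\}$. For $A=C_n^k$ (so $\ell_i=i$, $k_i=k$), $F(A)$ is the digraph on $[n]$ (labels mod $n$) with forward row arcs $a_i=(i-1,i+k-1)$ ($i\in[n]$, length $k$), forward short arcs $(j-1,j)$ (length $1$) and reverse short arcs $(j,j-1)$ (length $-1$). A circuit is a simple directed circuit; winding number $p(\Gamma)$: $p(\Gamma)n=$ sum of lengths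 of arcs of $\Gamma$. For a circuit $\Gamma$ of $F(A)$ with $s$ row arcs and $p(\Gamma)\ne0$: $t=\alpha s$, $\beta=\lfloor t/p(\Gamma)\rfloor$, $r=t-\beta p(\Gamma)$, $\otimes(\Gamma)=\{j:(j,j-1)\in E(\Gamma)\}$, and the $\Gamma$-inequality is $\sum_{j\in[n]}[\delta_j+r]x_j\ge r(\beta+1)$ where $\delta_j=1$ if $j\in\otimes(\Gamma)$ and $0$ otherwise (this is the general circuit inequality $\sum_j[p^-(\Gamma,j)+r]x_j\ge r(\beta+1)+\sum_{i:\bar a_i\in E(\Gamma)}b_i$ specialized to circuits without reverse row arcs, $p^-(\Gamma,j)$ being the number of reverse arcs of $\Gamma$ jumping over $j$, and the reverse short arc $(j,j-1)$ jumping over $j$ only). *)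

(* Defs.v *)
From HB Require Import structures.
From mathcomp Require Import all_boot all_order all_algebra.
From mathcomp Require Import reals.
Set Implicit Arguments. Unset Strict Implicit. Unset Printing Implicit Defensive.
Import Order.TTheory GRing.Theory Num.Theory.
Local Open Scope ring_scope.

(* Indices are 0-based: paper index j in [n] corresponds to j-1 in 'I_n. *)

Definition Qpoly (R : realType) (m n : nat) (A : 'M[R]_(m, n)) (b : 'I_m -> nat)
  (x : 'I_n -> R) : Prop :=
  (forall j, 0 <= x j) /\ (forall i, (b i)%:R <= \sum_j A i j * x j).

Definition is_integral_point (R : realType) (n : nat) (x : 'I_n -> R) : Prop :=
  exists z : 'I_n -> int, forall j, x j = (z j)%:~R.

Definition conv (R : realType) (n : nat) (S : ('I_n -> R) -> Prop)
  (x : 'I_n -> R) : Prop :=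
  exists (m : nat) (w : 'I_m -> R) (P : 'I_m -> 'I_n -> R),
    (forall i, 0 <= w i) /\ \sum_i w i = 1 /\ (forall i, S (P i)) /\
    (forall j, x j = \sum_i w i * P i j).

Definition Qstar (R : realType) (m n : nat) (A : 'M[R]_(m, n)) (b : 'I_m -> nat)
  (x : 'I_n -> R) : Prop :=
  conv (fun y => Qpoly A b y /\ is_integral_point y) x.

Definition is_tau (R : realType) (m n : nat) (A : 'M[R]_(m, n)) (b : 'I_m -> nat)
  (t : R) : Prop :=
  (exists y, Qstar A b y /\ \sum_j y j = t) /\
  (forall y, Qstar A b y -> t <= \sum_j y j).

(* C_n^k : row i (0-based) is the incidence vector of {i, ..., i+k-1} mod n *)
Definition Cnk (R : realType) (n k : nat) : 'M[R]_n :=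
  \matrix_(i < n, j < n) (if ((j + n - i) %% n < k)%N then 1 else 0).

(* Arcs of F(C_n^k), vertices are 0..n-1 (mod n):
   RowArc i   : row farc a_{i+1} = (i, i+k)        length  k
   FShort j   : forward short farc (j, j+1)        length  1
   RShort j   : reverse short farc (j+1, j)        length -1,
                which jumps over column j (0-based), i.e. paper column j+1. *)
Inductive farc := RowArc of nat | FShort of nat | RShort of nat.

Definition farc_idx (a : farc) : nat :=
  match a with RowArc i => i | FShort j => j | RShort j => j end.

Definition farc_tail (n k : nat) (a : farc) : nat :=
  match a with
  | RowArc i => i | FShort j => j | RShort j => (j.+1 %% n)%N end.

Definition farc_head (n k : nat) (a : farc) : nat :=
  match a with
  | RowArc i => ((i + k) %% n)%N | FShort j => (j.+1 %% n)%N | RShort j => j end.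

Definition farc_len (k : nat) (a : farc) : int :=
  match a with RowArc _ => k%:Z | FShort _ => 1 | RShort _ => -1 end.

Definition is_row (a : farc) : bool := if a is RowArc _ then true else false.
Definition is_fshort (a : farc) : bool := if a is FShort _ then true else false.
Definition is_rshort_at (j : nat) (a : farc) : bool :=
  if a is RShort j' then j' == j else false.

Definition is_circuit (n k : nat) (c : seq farc) : Prop :=
  (0 < size c)%N /\
  all (fun a => (farc_idx a < n)%N) c /\
  uniq (map (farc_tail n k) c) /\
  (forall t, (t < size c)%N ->
     farc_head n k (nth (FShort 0) c t) =
     farc_tail n k (nth (FShort 0) c ((t.+1) %% size c))).

(* winding number p(Γ): p(Γ) n = sum of farc lengths (the sum is a multiple of n) *)
Definition winding (n k : nat) (c : seq farc) : int :=
  ((\sum_(a <- c) farc_len k a) %/ n%:Z)%Z.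

(* Γ-inequality for b = α1 and Γ without reverse row arcs *)
Definition gamma_ineq (R : realType) (n k alpha : nat) (c : seq farc)
  (x : 'I_n -> R) : Prop :=
  let p := winding n k c in
  let s := count is_row c in
  let t : int := (alpha * s)%N%:Z in
  let beta : int := Num.floor ((t%:~R : rat) / (p%:~R : rat)) in
  let r : int := t - beta * p in
  ((r * (beta + 1))%:~R : R) <=
    \sum_(j < n) (((has (is_rshort_at j) c)%:R + r)%:~R * x j).

(* Main.v *)
Require Import Defs.
From HB Require Import structures.
From mathcomp Require Import all_boot all_order all_algebra.
From mathcomp Require Import classical_sets reals.
From mathcomp Require Import zify ring lra.
Set Implicit Arguments. Unset Strict Implicit. Unset Printing Implicit Defensive.
Import Order.TTheory GRing.Theory Num.Theory.
Local Open Scope ring_scope.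

(** Write [sigma = b + lam] for the sum of a point [x] of [Q], with [b] its floor.
    In terms of cumulative sums, the points of an integral slice are monotone
    sequences [F] with [F (j + n) = F j + N] and [F (j + k) >= F j + alpha]; the
    randomly shifted roundings [floor (F + s)], [s] uniform in [0, 1], are integral
    and average to [F], so integral slices lie in [Qstar].  It remains to write
    [x = u + v] with [u / (1 - lam)] and [v / lam] in the slices [b] and [b + 1].
    The constraints on [u] alone are a system of potential inequalities for row arcs
    and reverse short arcs, solvable because the circuit inequalities exclude
    circuits of positive weight; those on [v] alone are solved by a multiple of [x].
    Closing the solution for [u] under the constraints on [v] keeps it a solution
    for [u], because a row arc followed by a reverse row arc can be replaced by
    short arcs ([uncross]). *)

(** * Cyclic sequences and their cumulative sums *)

Lemma periodic_modn (T : Type) (f : nat -> T) (n : nat) :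
  (forall j, f (j + n)%N = f j) -> forall j, f (j %% n)%N = f j.
Proof.
move=> fD j; rewrite [in RHS](divn_eq j n) addnC.
elim: (j %/ n)%N => [|m IHm]; first by rewrite addn0.
by rewrite mulSn addnCA addnC fD.
Qed.

Section CyclicSequences.
Variables (R : realType) (n : nat).
Hypothesis n_gt0 : (0 < n)%N.
Implicit Types (x : 'I_n -> R) (F : nat -> R).

(** Periodic extension to [nat]; for [n > 0] the default [0] is never returned. *)
Definition ext x (j : nat) : R := oapp x 0 (insub (j %% n)%N).

Definition cum x (j : nat) : R := \sum_(0 <= i < j) ext x i.

Lemma ext_ord x (i : 'I_n) : ext x i = x i.
Proof. by rewrite /ext modn_small // valK. Qed.

Lemma ext_modn x j : ext x (j %% n) = ext x j.
Proof. by rewrite /ext modn_mod. Qed.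

Lemma ext_ge0 x : (forall i, 0 <= x i) -> forall j, 0 <= ext x j.
Proof. by move=> x0 j; rewrite /ext; case: insub => //=. Qed.

Lemma cumS x j : cum x j.+1 = cum x j + ext x j.
Proof. by rewrite /cum big_nat_recr. Qed.

Lemma cum0 x : cum x 0 = 0.
Proof. by rewrite /cum big_geq. Qed.

Lemma cum_n x : cum x n = \sum_j x j.
Proof. by rewrite /cum big_mkord; apply: eq_bigr => i _; rewrite ext_ord. Qed.

Lemma cumDn x j : cum x (j + n) = cum x j + \sum_i x i.
Proof.
elim: j => [|j IHj]; first by rewrite cum0 add0n cum_n add0r.
by rewrite addSn !cumS IHj -(ext_modn x (j + n)) modnDr ext_modn addrAC.
Qed.

Lemma cum_window x i m : cum x (i + m) - cum x i = \sum_(l < m) ext x (i + l).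
Proof.
elim: m => [|m IHm]; first by rewrite addn0 subrr big_ord0.
by rewrite addnS cumS big_ord_recr /= -IHm addrAC.
Qed.

Lemma cum_nondecreasing x : (forall i, 0 <= x i) ->
  forall i j, (i <= j)%N -> cum x i <= cum x j.
Proof.
move=> x0 i j /subnKC <-; rewrite -subr_ge0 cum_window.
by apply: sumr_ge0 => l _; apply: ext_ge0.
Qed.

Lemma Cnk_row_sum k x (i : 'I_n) : (k <= n)%N ->
  \sum_j Cnk R n k i j * x j = cum x (i + k) - cum x i.
Proof.
move=> lekn; rewrite cum_window.
(* [h] turns an offset from row [i] into a column and [h'] turns it back; the test defining [Cnk]
   reads [h' j < k]. *)
pose h (m : 'I_n) := Ordinal (ltn_pmod (i + m) n_gt0).
pose h' (j : 'I_n) := Ordinal (ltn_pmod (j + n - i) n_gt0).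
have hi := ltn_ord i.
have hK j : h (h' j) = j.
  apply: val_inj => /=; rewrite modnDmr subnKC; last by lia.
  by rewrite modnDr modn_small.
have h'K m : h' (h m) = m.
  apply: val_inj => /=; have hm := ltn_ord m.
  have [lt_n|le_n] := ltnP (i + m) n.
    by rewrite (modn_small lt_n) (_ : _ - _ = m + n)%N ?modnDr ?modn_small //; lia.
  have -> : ((i + m) %% n = i + m - n)%N.
    by rewrite -{1}(subnK le_n) modnDr modn_small //; lia.
  by rewrite (_ : _ - _ = m)%N ?modn_small //; lia.
rewrite (reindex_onto h h') => [|j _]; last exact: hK.
under eq_bigl do rewrite h'K eqxx.
rewrite (big_ord_widen n (fun l => ext x (i + l)) lekn) [RHS]big_mkcond /=.
apply: eq_bigr => m _; rewrite mxE.
have /= -> : val (h' (h m)) = m by rewrite h'K.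
rewrite -[x (h m)]ext_ord /= ext_modn.
by case: ifP; rewrite (mul1r, mul0r).
Qed.

Section Increments.
Variables (F : nat -> R) (c : R).
Hypothesis F_period : forall j, F (j + n)%N = F j + c.

Definition increments (j : 'I_n) : R := F j.+1 - F j.

Lemma ext_increments j : ext increments j = F j.+1 - F j.
Proof.
elim/ltn_ind: j => j IHj.
have [lt_jn|le_nj] := ltnP j n; first by rewrite -[j]/(val (Ordinal lt_jn)) ext_ord.
rewrite -(subnK le_nj) -ext_modn modnDr ext_modn IHj; last by lia.
rewrite -addSn !F_period.
by rewrite opprD addrACA subrr addr0.
Qed.

Lemma cum_increments j : cum increments j = F j - F 0%N.
Proof.
elim: j => [|j IHj]; first by rewrite cum0 subrr.
by rewrite cumS IHj ext_increments addrC addrA subrK.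
Qed.

Lemma sum_increments : \sum_j increments j = c.
Proof. by rewrite -cum_n cum_increments -{1}[n]add0n F_period addrAC subrr add0r. Qed.

End Increments.

Variable k : nat.
Hypothesis le_kn : (k <= n)%N.

Lemma Qpoly_cum alpha x : Qpoly (Cnk R n k) (fun=> alpha) x ->
  forall j, cum x j + alpha%:R <= cum x (j + k).
Proof.
move=> [_ hw] j; elim/ltn_ind: j => j IHj.
have [lt_jn|le_nj] := ltnP j n.
  by rewrite -lerBrDl; have := hw (Ordinal lt_jn); rewrite Cnk_row_sum.
have H : cum x (j - n) + alpha%:R <= cum x (j - n + k) by apply: IHj; lia.
by rewrite -(subnK le_nj) addnAC !cumDn addrAC lerD2r.
Qed.

Lemma Qpoly_increments alpha F c : (forall j, F (j + n)%N = F j + c) ->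
  (forall j, F j <= F j.+1) -> (forall j, F j + alpha%:R <= F (j + k)%N) ->
  Qpoly (Cnk R n k) (fun=> alpha) (increments F).
Proof.
move=> F_period F_mono F_win; split=> [j|i]; first by rewrite subr_ge0.
rewrite Cnk_row_sum // !(cum_increments F_period) opprB addrA subrK.
by rewrite lerBrDl.
Qed.

(** Double counting: the [n] window constraints together cover each column [k] times. *)
Lemma Qpoly_sum alpha x : Qpoly (Cnk R n k) (fun=> alpha) x ->
  (alpha * n)%:R <= k%:R * \sum_j x j.
Proof.
move=> hx; suff <- : \sum_(i < n) (cum x (i + k) - cum x i) = k%:R * \sum_j x j.
  have -> : (alpha * n)%:R = \sum_(i < n) alpha%:R :> R.
    by rewrite sumr_const card_ord natrM mulr_natr.
  by apply: ler_sum => i _; rewrite lerBrDl Qpoly_cum.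
under eq_bigr do rewrite cum_window.
rewrite exchange_big /=.
under eq_bigr => l _.
  under eq_bigr do rewrite addnC.
  rewrite -cum_window cumDn addrAC subrr add0r.
  over.
by rewrite sumr_const card_ord mulr_natl.
Qed.

End CyclicSequences.

(** * Convex hulls *)

Section ConvexHull.
Variables (R : realType) (n : nat) (S : ('I_n -> R) -> Prop).

Lemma conv_linear_ge (g : 'I_n -> R) (c : R) (x : 'I_n -> R) :
  (forall y, S y -> c <= \sum_j g j * y j) -> conv S x -> c <= \sum_j g j * x j.
Proof.
move=> gS [m [w [P [w0 [w1 [SP xP]]]]]].
under eq_bigr do rewrite xP mulr_sumr.
rewrite exchange_big /= -[c]mul1r -w1 mulr_suml; apply: ler_sum => i _.
under eq_bigr do rewrite mulrCA.
by rewrite -mulr_sumr ler_wpM2l // gS.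
Qed.

Lemma conv_ext (x y : 'I_n -> R) : (forall j, x j = y j) -> conv S y -> conv S x.
Proof.
move=> xy [m [w [P [w0 [w1 [SP yP]]]]]]; exists m, w, P; do 3 split=> //.
by move=> j; rewrite xy.
Qed.

Lemma conv_convex (a b : R) (x y z : 'I_n -> R) : 0 <= a -> 0 <= b -> a + b = 1 ->
  conv S y -> conv S z -> (forall j, x j = a * y j + b * z j) -> conv S x.
Proof.
move=> a0 b0 ab [m1 [w1 [P1 [w10 [w11 [SP1 xP1]]]]]] [m2 [w2 [P2 [w20 [w21 [SP2 xP2]]]]]] xyz.
exists (m1 + m2)%N,
  (fun i => match split i with inl i1 => a * w1 i1 | inr i2 => b * w2 i2 end),
  (fun i => match split i with inl i1 => P1 i1 | inr i2 => P2 i2 end).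
have splitl i : split (lshift m2 i) = inl i :> 'I_m1 + 'I_m2 by apply: (unsplitK (inl i)).
have splitr i : split (rshift m1 i) = inr i :> 'I_m1 + 'I_m2 by apply: (unsplitK (inr i)).
split; first by move=> i; case: split => j; rewrite mulr_ge0.
split.
  rewrite big_split_ord /=; under eq_bigr do rewrite splitl.
  under [X in _ + X]eq_bigr do rewrite splitr.
  by rewrite -!mulr_sumr w11 w21 !mulr1.
split; first by move=> i; case: split => j.
move=> j; rewrite big_split_ord /=; under eq_bigr do rewrite splitl -mulrA.
under [X in _ + X]eq_bigr do rewrite splitr -mulrA.
by rewrite -!mulr_sumr -xP1 -xP2.
Qed.

End ConvexHull.

(** * Integral slices by shifted rounding *)

Section Rounding.
Variable R : realType.

(** The steps from [i0] on telescope; an earlier index passing the test lies on a plateau of value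
    [g i0], where the step is zero. *)
Lemma sum_steps_above (g : nat -> R) (i0 m : nat) : (i0 <= m)%N ->
  (forall i, (i < m)%N -> g i <= g i.+1) ->
  \sum_(i < m) (g i.+1 - g i) * (g i0 <= g i)%R%:R = g m - g i0.
Proof.
move=> le_i0m g_mono.
have mono i j : (i <= j <= m)%N -> g i <= g j.
  elim: j => [|j IHj]; first by rewrite leqn0 => /andP[/eqP->].
  move=> /andP[]; rewrite leq_eqVlt => /predU1P[-> // | lt_ij] lt_jm.
  by rewrite (le_trans (IHj _)) ?g_mono //; lia.
rewrite -(big_mkord predT (fun i => (g i.+1 - g i) * (g i0 <= g i)%R%:R)).
rewrite (big_cat_nat (leq0n i0) le_i0m) /= -(telescope_sumr _ le_i0m) big_nat big1.
  rewrite add0r; apply: eq_big_nat => i /andP[le_i0i lt_im].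
  by rewrite mono ?mulr1 //; lia.
move=> i lt_ii0; case: (leP (g i0) (g i)) => [le_g|]; last by rewrite mulr0.
suff -> : g i.+1 = g i by rewrite subrr mul0r.
apply/eqP; rewrite eq_le (le_trans _ le_g) ?mono //; lia.
Qed.

(* The weights are the gaps between consecutive thresholds: they discretize the
   uniform distribution of s on [0, 1]. *)
Lemma threshold_weights (T : seq R) : (forall t, t \in T -> 0 <= t <= 1) ->
  exists (m : nat) (w s : 'I_m -> R),
    [/\ forall i, 0 <= w i, \sum_i w i = 1, forall i, 0 <= s i <= 1
      & forall t, t \in T -> \sum_i w i * (t <= s i)%R%:R = 1 - t].
Proof.
move=> T01; pose U := sort <=%R [:: 0, 1 & T]; pose g := nth 0 U.
have szU : size U = (size T).+2 by rewrite size_sort.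
have U01 t : t \in U -> 0 <= t <= 1.
  rewrite mem_sort !inE => /or3P[/eqP->|/eqP->|/T01 //]; rewrite ?lexx ?ler01 //.
have sU : sorted <=%R U by apply: sort_sorted; apply: le_total.
have g01 i : (i < (size T).+2)%N -> 0 <= g i <= 1.
  by move=> ltiT; apply: U01; rewrite mem_nth ?szU.
have mono i j : (i <= j)%N -> (j < (size T).+2)%N -> g i <= g j.
  move=> le_ij lt_j; apply: (sorted_leq_nth le_trans le_refl) => //;
    by rewrite inE szU; lia.
have gE t : t \in U -> exists2 i, (i < (size T).+2)%N & t = g i.
  by move=> tU; exists (index t U); rewrite ?/g ?nth_index // -szU index_mem.
have g0 : g 0%N = 0.
  have [|i lti Ei] := gE 0; first by rewrite mem_sort !inE eqxx.
  by apply/le_anti; have /andP[-> _] := g01 0%N isT; rewrite andbT (le_trans (mono 0%N i _ _)) -?Ei.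
have gm : g (size T).+1 = 1.
  have [|i lti Ei] := gE 1; first by rewrite mem_sort !inE eqxx orbT.
  apply/eqP; rewrite eq_le; have /andP[_ ->] /= := g01 (size T).+1 (ltnSn _).
  by rewrite Ei mono.
(* Each gap is charged to its left end, so the points [s i] at or above a threshold [t] carry
   exactly the length of [[t, 1]]. *)
exists (size T).+1, (fun i => g i.+1 - g i), (fun i => g i); split.
- by move=> i; rewrite subr_ge0 mono // ltnS.
- rewrite -(big_mkord predT (fun i => g i.+1 - g i)) telescope_sumr //.
  by rewrite gm g0 subr0.
- by case=> i lti; apply: g01; rewrite /=; lia.
move=> t tT; have [|i lti ->] := gE t; first by rewrite mem_sort !inE tT !orbT.
rewrite sum_steps_above ?gm // => j ltj; exact: mono.
Qed.

(** The shift carries [y] past the next integer exactly when [s] reaches one minus the fractional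
    part of [y]. *)
Lemma floorD_threshold (y s : R) : 0 <= s <= 1 ->
  (Num.floor (y + s))%:~R = (Num.floor y)%:~R + (1 - (y - (Num.floor y)%:~R) <= s)%R%:R :> R.
Proof.
move=> /andP[s0 s1]; have /andP[] := floor_itv y; rewrite intrD => f1 f2.
case: leP => h; rewrite ?addr0 -?[_ + true%:R]/(_ + 1%:~R) -?intrD; congr (_%:~R);
  by apply: floor_def; rewrite !intrD; lra.
Qed.

Variables (n k alpha : nat).
Hypotheses (n_gt0 : (0 < n)%N) (le_kn : (k <= n)%N).

Lemma Qstar_increments (F : nat -> R) (N : int) :
  (forall j, F (j + n)%N = F j + N%:~R) ->
  (forall j, F j <= F j.+1) -> (forall j, F j + alpha%:R <= F (j + k)%N) ->
  Qstar (Cnk R n k) (fun=> alpha) (fun j : 'I_n => F j.+1 - F j).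
Proof.
move=> F_period F_mono F_win.
pose frac j := F j - (Num.floor (F j))%:~R.
have [|m [w [s [w0 w1 s01 ws]]]] := @threshold_weights [seq 1 - frac j | j <- iota 0 n.+1].
  move=> t /mapP[j _ ->]; have /andP[] := floor_itv (F j); rewrite intrD /frac; lra.
pose G (i : 'I_m) j : R := (Num.floor (F j + s i))%:~R.
have GE j : (j <= n)%N -> \sum_i w i * G i j = F j.
  move=> le_jn; rewrite /G; under eq_bigr do rewrite floorD_threshold // mulrDr.
  rewrite big_split /= -mulr_suml w1 ws /frac; first by lra.
  by apply/mapP; exists j; rewrite // mem_iota.
exists m, w, (fun i => increments (G i)); split=> //; split=> //; split=> [i|j]; last first.
  by rewrite -!GE //; last exact: ltnW; rewrite -sumrB; apply: eq_bigr => i _; rewrite mulrBr.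
split; last first.
  exists (fun j : 'I_n => Num.floor (F j.+1 + s i) - Num.floor (F j + s i)) => j.
  by rewrite intrB.
(* As [N] and [alpha] are integers, rounding with one common shift keeps the period and the window
   bounds. *)
apply: (Qpoly_increments n_gt0 le_kn (c := N%:~R)).
- move=> j; rewrite /G F_period addrAC -intrD; congr (_%:~R); apply: floor_def.
  by have /andP[] := floor_itv (F j + s i); rewrite !intrD => h1 h2; lra.
- by move=> j; rewrite ler_int le_floor // lerD2r.
move=> j; rewrite /G -[alpha%:R]/((alpha%:Z)%:~R) -intrD ler_int floor_ge_int intrD.
by have := F_win j; have /andP[] := floor_itv (F j + s i); rewrite /=; lra.
Qed.

End Rounding.

(** * Circuits, winding numbers and arc weights *)

Definition farc_code (e : farc) : nat + nat + nat :=
  match e with RowArc i => inl (inl i) | FShort j => inl (inr j) | RShort j => inr j end.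

Definition farc_decode (u : nat + nat + nat) : farc :=
  match u with inl (inl i) => RowArc i | inl (inr j) => FShort j | inr j => RShort j end.

Lemma farc_codeK : cancel farc_code farc_decode.
Proof. by case. Qed.

HB.instance Definition _ := Equality.copy farc (can_type farc_codeK).

Section Circuits.
Variables (R : realType) (n k : nat).
Hypothesis n_gt0 : (0 < n)%N.
Implicit Types (c : seq farc) (x : 'I_n -> R) (a : R).

Lemma circuit_heads c : is_circuit n k c ->
  map (farc_head n k) c = rot 1 (map (farc_tail n k) c).
Proof.
case: c => [[] // | e c [_ [_ [_ hc]]]]; rewrite [map (farc_tail n k) _]/= rot1_cons.
apply: (@eq_from_nth _ 0%N) => [|i]; rewrite size_map ?size_rcons ?size_map // => lti.
rewrite (nth_map (FShort 0)) // hc // nth_rcons size_map.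
move: lti; rewrite /= ltnS leq_eqVlt => /predU1P[->|lti]; first by rewrite ltnn eqxx modnn.
by rewrite lti modn_small // (nth_map (FShort 0)).
Qed.

(** The heads are a rotation of the tails, so the two sums agree. *)
Lemma circuit_balance (V : zmodType) (h : nat -> V) c : is_circuit n k c ->
  \sum_(e <- c) (h (farc_head n k e) - h (farc_tail n k e)) = 0.
Proof.
move=> /circuit_heads hc; rewrite sumrB.
rewrite -(big_map (farc_head n k) predT h) -(big_map (farc_tail n k) predT h) hc.
apply/eqP; rewrite subr_eq0; apply/eqP; apply: perm_big.
by rewrite perm_rot.
Qed.

Lemma circuit_size c : is_circuit n k c -> (size c <= n)%N.
Proof.
move=> [_ [c_idx [c_uniq _]]]; rewrite -(size_map (farc_tail n k)) -[leqRHS](size_iota 0 n).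
apply: uniq_leq_size => // v /mapP[e ec ->]; rewrite mem_iota /= add0n.
by move/allP: c_idx => /(_ e ec); case: e {ec} => //= j _; apply: ltn_pmod.
Qed.

(** Modulo [n] the length of an arc is head minus tail, and these differences cancel around a
    circuit; hence the division in [winding] is exact. *)
Lemma winding_mul c : is_circuit n k c ->
  winding n k c * n%:Z = \sum_(e <- c) farc_len k e.
Proof.
move=> hc; rewrite /winding divzK //.
have -> : \sum_(e <- c) farc_len k e =
    \sum_(e <- c) (farc_len k e - ((farc_head n k e)%:Z - (farc_tail n k e)%:Z)).
  by rewrite sumrB (circuit_balance Posz hc) subr0.
have [_ [/allP c_idx _]] := hc.
rewrite big_seq; apply: rpred_sum => e /c_idx.
have key u : (n%:Z %| u%:Z - (u %% n)%N%:Z)%Z.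
  by rewrite {1}(divn_eq u n) PoszD addrK PoszM dvdz_mull.
case: e => [i|j|j] /= _.
- by have := key (i + k)%N; rewrite PoszD; congr (_ %| _)%Z; lia.
- by have := key j.+1; congr (_ %| _)%Z; lia.
by have := key j.+1; rewrite -rpredN; congr (_ %| _)%Z; lia.
Qed.

(** Without forward short arcs the total length is [(k + 1) * rows - size], with [size <= n]; a
    length of at most [-n] leaves no room for a row arc. *)
Lemma winding_lt0_rows c : is_circuit n k c -> ~~ has is_fshort c ->
  winding n k c < 0 -> count is_row c = 0%N.
Proof.
move=> hc c_fs p_lt0; have := winding_mul hc; have := circuit_size hc.
have -> : \sum_(e <- c) farc_len k e = (k.+1 * count is_row c)%N%:Z - (size c)%:Z.
  elim: c c_fs {hc p_lt0} => [|e c IHc] /=; first by rewrite big_nil muln0.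
  rewrite negb_or big_cons => /andP[e_fs /IHc ->].
  by case: e e_fs => //= j _; lia.
by nia.
Qed.

(** An arc from [u] to [v] of weight [w] encodes [f u + w <= f v]: row arcs ask for window sums of
    at least [a], reverse short arcs for steps of at most [x]. *)
Definition arc_weight a x (e : farc) : R :=
  match e with RowArc _ => a | FShort _ => 0 | RShort j => - ext x j end.

Definition rshort_sum c x : R := \sum_(j < n) (has (is_rshort_at j) c)%:R * x j.

Lemma rshort_sum_ge0 c x : (forall j, 0 <= x j) -> 0 <= rshort_sum c x.
Proof. by move=> x0; apply: sumr_ge0 => j _; rewrite mulr_ge0 ?ler0n. Qed.

Lemma sum_arc_weight a c x : is_circuit n k c ->
  \sum_(e <- c) arc_weight a x e = a * (count is_row c)%:R - rshort_sum c x.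
Proof.
move=> [_ [c_idx [c_uniq _]]].
(* Reverse short arcs at [j] share their tail, so distinct tails allow at most one, and [has] equals
   [count]. *)
have -> : rshort_sum c x = \sum_(j < n) (count (is_rshort_at j) c)%:R * x j.
  apply: eq_bigr => j _; congr (_%:R * _); apply/eqP.
  have : (count (is_rshort_at j) c <= 1)%N.
    rewrite (leq_trans (_ : _ <= count (pred1 (j.+1 %% n)%N) (map (farc_tail n k) c))%N) //.
      by rewrite count_map; apply: sub_count => -[] //= i /eqP ->.
    by rewrite count_uniq_mem // leq_b1.
  by rewrite has_count; case: (count _ _) => [|[]].
elim: c c_idx {c_uniq} => [|e c IHc] /=; first by rewrite big_nil mulr0 big1 ?subrr // => j _; rewrite mul0r.
move=> /andP[e_idx /IHc]; rewrite big_cons => ->.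
under [X in _ = _ - X]eq_bigr do rewrite natrD mulrDl.
rewrite big_split /= natrD mulrDr opprD addrACA; congr (_ + _).
case: e e_idx => [i|j|j] /= lt_n; rewrite ?mulr1 ?mulr0.
- by rewrite big1 ?subr0 // => l _; rewrite mul0r.
- by rewrite big1 ?subr0 // => l _; rewrite mul0r.
rewrite (bigD1 (Ordinal lt_n)) //= eqxx mul1r big1 ?addr0 ?sub0r.
  by rewrite -[j]/(val (Ordinal lt_n)) ext_ord.
by move=> l; rewrite -val_eqE /= eq_sym => /negPf ->; rewrite mul0r.
Qed.

(* Tilting the cumulative sums by a linear term makes them a function on Z/n,
   whose variation along a circuit vanishes. *)
Lemma circuit_cover alpha c x : (k <= n)%N ->
  Qpoly (Cnk R n k) (fun=> alpha) x -> is_circuit n k c -> ~~ has is_fshort c ->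
  (alpha * count is_row c)%:R - rshort_sum c x <= (winding n k c)%:~R * \sum_j x j.
Proof.
move=> le_kn xQ hc c_fs; rewrite natrM -sum_arc_weight //.
set sg := \sum_j x j; pose h v := cum x v - sg / n%:R * v%:R.
have n0 : n%:R != 0 :> R by rewrite pnatr_eq0 -lt0n.
have h_mod : forall v, h (v %% n)%N = h v.
  by apply: periodic_modn => v; rewrite /h cumDn // -/sg natrD; field.
have -> : (winding n k c)%:~R * sg = \sum_(e <- c) sg / n%:R * (farc_len k e)%:~R.
  by rewrite -mulr_sumr -rmorph_sum /= -winding_mul // intrM; field.
have -> : \sum_(e <- c) sg / n%:R * (farc_len k e)%:~R =
    \sum_(e <- c) (sg / n%:R * (farc_len k e)%:~R +
                   (h (farc_head n k e) - h (farc_tail n k e))).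
  by rewrite big_split /= circuit_balance // addr0.
(* The bound holds arc by arc: a row arc gives its window constraint, a reverse short arc an
   equality. *)
rewrite big_seq [leRHS]big_seq; apply: ler_sum => e ec; have {ec} : ~~ is_fshort e by move/hasPn: c_fs; apply.
case: e => [i|j|j] //= _; rewrite h_mod /h.
  by rewrite natrD; have := Qpoly_cum n_gt0 le_kn xQ i; lra.
by rewrite cumS -natr1; lra.
Qed.

End Circuits.

(** * Validity of the circuit inequalities at integral points *)

Lemma floor_divq_itv (t p : int) : 0 < p ->
  Num.floor (t%:~R / p%:~R : rat) * p <= t < (Num.floor (t%:~R / p%:~R : rat) + 1) * p.
Proof.
move=> p0; have := floor_itv (t%:~R / p%:~R : rat).
by rewrite ler_pdivlMr ?ltr0z // ltr_pdivrMr ?ltr0z // -!intrM ler_int ltr_int.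
Qed.

Lemma floor_divq_unique (t p b : int) : 0 < p -> b * p <= t < (b + 1) * p ->
  Num.floor (t%:~R / p%:~R : rat) = b.
Proof.
move=> p0 tb; apply: floor_def.
by rewrite ler_pdivlMr ?ltr0z // ltr_pdivrMr ?ltr0z // -!intrM ler_int ltr_int.
Qed.

Section GammaInequalities.
Variables (R : realType) (n k alpha : nat).
Hypotheses (n_gt0 : (0 < n)%N) (le_kn : (k <= n)%N).
Implicit Types (c : seq farc) (x : 'I_n -> R).

Lemma gamma_ineqE c x (p := winding n k c) (t := (alpha * count is_row c)%N%:Z)
    (b := Num.floor (t%:~R / p%:~R : rat)) :
  gamma_ineq k alpha c x <->
  ((t - b * p) * (b + 1))%:~R <= rshort_sum c x + (t - b * p)%:~R * \sum_j x j.
Proof.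
rewrite /gamma_ineq -/p -/t -/b mulr_sumr -big_split /=.
by under eq_bigr do rewrite intrD mulrDl natz -pmulrn.
Qed.

(** Let [p > 0], [r = t - b * p] and [sg] be the integral sum. If [sg >= b + 1], the term [r * sg]
    suffices. Otherwise [sg <= b], and [circuit_cover] bounds the reverse short sum below by [t - p
    * sg = r + p * (b - sg) >= r * (b + 1 - sg)], as [r < p]. *)
Lemma gamma_ineq_integral c x :
  Qpoly (Cnk R n k) (fun=> alpha) x -> is_integral_point x ->
  is_circuit n k c -> ~~ has is_fshort c -> winding n k c != 0 ->
  gamma_ineq k alpha c x.
Proof.
move=> xQ [z xz] hc c_fs p_neq0; apply/gamma_ineqE.
have := circuit_cover n_gt0 le_kn xQ hc c_fs.
have := rshort_sum_ge0 c xQ.1.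
have -> : \sum_j x j = (\sum_j z j)%:~R.
  by rewrite rmorph_sum /=; apply: eq_bigr => j _; rewrite xz.
have := winding_lt0_rows n_gt0 hc c_fs.
set p := winding n k c in p_neq0 *; set sg := \sum_j z j.
move: (rshort_sum c x) => o p_neg o_ge0.
have [p_lt0|p_gt0|p0] := ltrgtP p 0; last by rewrite p0 eqxx in p_neq0.
  (* A negative winding number leaves no row arcs, so [t = 0] and the inequality reduces to
     [0 <= o]. *)
  by move=> _; rewrite p_neg // muln0 mul0r floor0 mul0r subr0 !mul0r addr0.
rewrite [(alpha * _)%:R]pmulrn.
set t := (alpha * _)%N%:Z => cover.
have := floor_divq_itv t p_gt0; move: (Num.floor _) => b /andP[bt tb].
have [ge_sg|lt_sg] := lerP (b + 1) sg.
  rewrite -[leLHS]add0r lerD // -intrM ler_int ler_wpM2l //; lia.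
rewrite -lerBlDr -intrM -intrB; apply: le_trans (_ : (t - p * sg)%:~R <= _); last first.
  by rewrite intrB intrM lerBlDr; move: cover; rewrite lerBlDr addrC.
by rewrite ler_int; nia.
Qed.

End GammaInequalities.

(** * Potentials from longest paths *)

Section Potentials.
Variables (R : realType) (n k : nat) (w : farc -> R) (M : R).
Hypothesis n_gt0 : (0 < n)%N.

Fixpoint walk (u : nat) (P : seq farc) (v : nat) : bool :=
  if P is e :: P' then (farc_tail n k e == u) && walk (farc_head n k e) P' v else u == v.

Lemma walk_cat u P1 e P2 v : walk u (P1 ++ e :: P2) v =
  walk u P1 (farc_tail n k e) && walk (farc_tail n k e) (e :: P2) v.
Proof.
elim: P1 u => [|e1 P1 IH] u /=; first by rewrite eqxx eq_sym.
by rewrite IH /= andbA.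
Qed.

Lemma walk_head u P v t : walk u P v -> (t < size P)%N ->
  farc_head n k (nth (FShort 0) P t) = nth v (map (farc_tail n k) P) t.+1.
Proof.
elim: P u t => [|e P IH] u [|t] //= /andP[_ hP] => [_|]; last exact: IH hP.
by case: P hP {IH} => [/eqP|e' P /= /andP[/eqP]].
Qed.

Lemma closed_walk_circuit v e P : walk v (e :: P) v ->
  all (fun a => farc_idx a < n)%N (e :: P) -> uniq (map (farc_tail n k) (e :: P)) ->
  is_circuit n k (e :: P).
Proof.
move=> hw h_idx h_uniq; do 3 split=> //; move=> t lt_t.
rewrite (walk_head hw lt_t); have [eq_t|lt_t1] := eqVneq t.+1 (size (e :: P)).
  rewrite eq_t modnn nth_default ?size_map //=.
  by have /= /andP[/eqP] := hw.
have {lt_t1}lt_t1 : (t.+1 < size (e :: P))%N by rewrite ltn_neqAle lt_t1.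
by rewrite modn_small // (nth_map (FShort 0)).
Qed.

Definition row_or_rshort (e : farc) := (farc_idx e < n)%N && ~~ is_fshort e.

Hypothesis w_le : forall e, row_or_rshort e -> w e <= M.
Hypothesis circuit_le0 : forall c, is_circuit n k c -> ~~ has is_fshort c ->
  \sum_(e <- c) w e <= 0.

(** Requiring [v] to differ from all tails keeps the tails distinct after an arc out of [v] is
    appended. *)
Definition simple_path (P : seq farc) (v : nat) :=
  (exists u, walk u P v) /\ all row_or_rshort P /\ uniq (rcons (map (farc_tail n k) P) v).

Definition path_weights (v : nat) (r : R) : Prop :=
  exists2 P, simple_path P v & r = \sum_(e <- P) w e.

Definition potential (v : nat) : R := sup (path_weights v).

Lemma path_weights_has_sup v : has_sup (path_weights v).
Proof.
split.
  by exists 0, [::]; [split; [exists v; rewrite /= | ] | rewrite big_nil].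
(* A simple path has at most [n] arcs, each of weight at most [Num.max M 0]. *)
exists (n%:R * Num.max M 0) => r [P [_ [P_ok P_uniq]] ->].
have size_le : (size P <= n)%N.
  rewrite -(size_map (farc_tail n k)) -[leqRHS](size_iota 0 n).
  move: P_uniq; rewrite rcons_uniq => /andP[_ P_uniq].
  apply: uniq_leq_size => // u /mapP[e eP ->]; rewrite mem_iota add0n /=.
  have /allP/(_ e eP)/andP[] := P_ok; case: e {eP} => //= j _ _; exact: ltn_pmod.
apply: (@le_trans _ _ ((size P)%:R * Num.max M 0)); last first.
  by rewrite ler_wpM2r ?ler_nat // le_max lexx orbT.
elim: P P_ok {P_uniq size_le} => [|e P IH] /=; first by rewrite big_nil mul0r.
move=> /andP[/w_le e_le /IH P_le]; rewrite big_cons -natr1 mulrDl mul1r addrC.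
by rewrite lerD // le_max e_le.
Qed.

Lemma potential_arc e : row_or_rshort e ->
  potential (farc_tail n k e) + w e <= potential (farc_head n k e).
Proof.
move=> e_ok; rewrite -lerBrDr.
have [ne0 _] := path_weights_has_sup (farc_tail n k e).
apply: ge_sup ne0 _ => r [P [[u uP] [P_ok P_uniq]] ->].
rewrite lerBrDr; pose Q := rcons P e; set h := farc_head n k e.
have -> : \sum_(e <- P) w e + w e = \sum_(e <- Q) w e by rewrite big_rcons /= addrC.
have uQ : walk u Q h by rewrite /Q -cats1 walk_cat uP /= !eqxx.
have Q_ok : all row_or_rshort Q by rewrite all_rcons e_ok.
have Q_uniq : uniq (map (farc_tail n k) Q) by rewrite map_rcons.
have h_ub := ub_le_sup (path_weights_has_sup h).2.
have [hQ|hQ] := boolP (h \in map (farc_tail n k) Q); last first.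
  by apply: h_ub; exists Q => //; split; [exists u | rewrite rcons_uniq hQ].
have /mapP[e' e'Q h_e'] := hQ.
case/splitPr: e'Q uQ Q_ok Q_uniq => Q1 Q2; rewrite walk_cat -h_e' => /andP[uQ1 hQ2].
rewrite all_cat => /andP[Q1_ok Q2_ok]; rewrite map_cat cat_uniq => /and3P[Q1_uniq disj Q2_uniq].
rewrite big_cat /= -[leRHS]addr0 lerD //.
  apply: h_ub; exists Q1 => //; split; first by exists u.
  split=> //; rewrite rcons_uniq Q1_uniq andbT.
  by move: disj; rewrite /= negb_or -h_e' => /andP[].
apply: circuit_le0.
  by apply: closed_walk_circuit hQ2 _ Q2_uniq; apply: sub_all Q2_ok => f /andP[].
by rewrite -all_predC; apply: sub_all Q2_ok => f /andP[].
Qed.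

End Potentials.

(** * Closing a solution for [u] under the constraints on [v] *)

Section Uncrossing.
Variables (R : realType) (n k : nat) (X rho0 U : nat -> R) (sg V a l : R).
Hypotheses (X_period : forall j, X (j + n)%N = X j + sg)
  (X_mono : forall i j, (i <= j)%N -> X i <= X j)
  (X_win : forall j, X j + (a + l) <= X (j + k)%N).
Hypotheses (rho0_period : forall j, rho0 (j + n)%N = rho0 j + V)
  (rho0_mono : forall j, rho0 j <= rho0 j.+1)
  (rho0_win : forall j, rho0 (j + k)%N <= rho0 j + (X (j + k)%N - X j) - a).
Hypotheses (U_period : forall j, U (j + n)%N = U j + V)
  (U_mono : forall j, U j <= U j.+1)
  (U_lip : forall j, U j.+1 <= U j + (X j.+1 - X j))
  (U_win : forall j, U j + l <= U (j + k)%N)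
  (rho0_U : forall j, rho0 j <= U j).

(* The weight of the best walk of short arcs from [i] to [j]. *)
Let D i j := Num.min 0 (X j - X i).

Let D_le0 i j : D i j <= 0. Proof. by rewrite ge_min lexx. Qed.
Let D_le i j : D i j <= X j - X i. Proof. by rewrite ge_min lexx orbT. Qed.

Let D_tri i j m : D i j + D j m <= D i m.
Proof.
rewrite le_min; have := D_le0 i j; have := D_le0 j m; have := D_le i j; have := D_le j m.
by move=> *; apply/andP; split; lra.
Qed.

Let D_period i j : D (i + n) (j + n) = D i j.
Proof. by rewrite /D !X_period; congr Num.min; lra. Qed.

Let nat_mono (f : nat -> R) : (forall j, f j <= f j.+1) ->
  forall i j, (i <= j)%N -> f i <= f j.
Proof. by move=> hf i j le_ij; apply: (homo_leq le_refl le_trans hf). Qed.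

Let U_D i j : U i + D i j <= U j.
Proof.
have [le_ij|lt_ji] := leqP i j.
  by have := nat_mono U_mono le_ij; have := D_le0 i j; lra.
have : X j - U j <= X i - U i.
  by apply: (nat_mono (f := fun j => X j - U j)) (ltnW lt_ji) => m; have := U_lip m; lra.
by have := D_le i j; lra.
Qed.

(* Replacing a row arc from i followed by a walk to j + k and a reverse row arc
   to j by a walk of short arcs from i to j does not decrease the weight. *)
Let uncross i j : a + l + D (i + k) (j + k) <= D i j + (X (j + k)%N - X j).
Proof.
rewrite -lerBlDr le_min; have := D_le0 (i + k) (j + k); have := D_le (i + k) (j + k).
by have := X_win i; have := X_win j => *; apply/andP; split; lra.
Qed.

(** Lower bounds that the constraints on [v] force on a sequence above [rho0]. Each row step ends
    with a short walk [D], so further short walks are absorbed by [D_tri]; the shift by [n] is built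
    in downwards only, and [reach_up] derives the other direction. *)
Inductive reach : nat -> R -> Prop :=
| reach_init i j : reach j (rho0 i + D i j)
| reach_row i j v : reach i v -> reach j (v + l + D (i + k) j)
| reach_down j v : reach (j + n) v -> reach j (v - V).

(** [U] lies above [rho0] and satisfies the constraints on [v]; this makes the suprema finite. *)
Lemma reach_le j v : reach j v -> v <= U j.
Proof.
elim=> {j v} [i j | i j v _ IH | j v _ IH].
- by have := U_D i j; have := rho0_U i; lra.
- by have := U_D (i + k) j; have := U_win i; lra.
by have := U_period j; lra.
Qed.

Lemma reach_short i v : reach i v -> forall j, exists2 v', reach j v' & v + D i j <= v'.
Proof.
elim=> {i v} [i0 i j | i0 i v h IH j | i v _ IH j].
- by exists (rho0 i0 + D i0 j); [constructor | have := D_tri i0 i j; lra].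
- exists (v + l + D (i0 + k) j); first exact: reach_row.
  by have := D_tri (i0 + k) i j; lra.
have [v' h' hv'] := IH (j + n)%N.
by exists (v' - V); [constructor | rewrite D_period in hv'; lra].
Qed.

Lemma reach_up j v : reach j v -> exists2 v', reach (j + n) v' & v + V <= v'.
Proof.
elim=> {j v} [i j | i j v _ [v' h' hv'] | j v h _].
- exists (rho0 (i + n)%N + D (i + n) (j + n)); first by constructor.
  by rewrite D_period rho0_period; lra.
- exists (v' + l + D (i + n + k) (j + n)); first exact: reach_row.
  by rewrite (addnAC i) D_period; lra.
by exists v => //; lra.
Qed.

(** The closure preserves the row constraint on [u], a reverse row arc for [rho]: after a row step,
    [uncross] replaces both row arcs by short arcs; at an initial value, [rho0_win] applies. *)
Lemma reach_back i v : reach i v -> forall j, i = (j + k)%N ->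
  exists2 v', reach j v' & v + (a - (X (j + k)%N - X j)) <= v'.
Proof.
elim=> {i v} [i0 i j -> | i0 i v h _ j -> | i v _ IH j ij].
(* A start [i0 <= j + k] is advanced to [j + k] by monotonicity and pulled back to [j]; a later
   start [m + k] is pulled back to [m], whence reverse short arcs lead to [j]. *)
- have [le_i0|lt_i0] := leqP i0 (j + k).
    exists (rho0 j + D j j); first by constructor.
    have -> : D j j = 0 by rewrite /D subrr minxx.
    have := nat_mono rho0_mono le_i0; have := rho0_win j; have := D_le0 i0 (j + k); lra.
  have [m lt_jm ->] : exists2 m, (j < m)%N & i0 = (m + k)%N.
    by exists (i0 - k)%N; lia.
  exists (rho0 m + D m j); first by constructor.
  have -> : D m j = X j - X m by apply/min_idPr; rewrite subr_le0 X_mono // ltnW.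
  by have := rho0_win m; have := D_le (m + k) (j + k); lra.
- have [v' h' hv'] := reach_short h j; exists v' => //.
  by have := uncross i0 j; lra.
have [|v' h' hv'] := IH (j + n)%N; first by rewrite ij addnAC.
exists (v' - V); first by constructor.
by move: hv'; rewrite addnAC !X_period; lra.
Qed.

Let rho j := sup (reach j).

Let reach_has_sup j : has_sup (reach j).
Proof.
split; first by exists (rho0 j + D j j); constructor.
by exists (U j) => v; apply: reach_le.
Qed.

Let rho_step i j d :
  (forall v, reach i v -> exists2 v', reach j v' & v + d <= v') -> rho i + d <= rho j.
Proof.
move=> H; rewrite -lerBrDr; apply: ge_sup; first by have [] := reach_has_sup i.
move=> v /H[v' h' hv']; rewrite lerBrDr (le_trans hv') //.
by apply: ub_le_sup h'; have [] := reach_has_sup j.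
Qed.

(** The supremum of the reachable values works: the first four properties come from closure, the
    last from [reach_back]. *)
Lemma uncrossing : exists rho : nat -> R,
  [/\ forall j, rho (j + n)%N = rho j + V,
      forall j, rho j <= rho j.+1,
      forall j, rho j.+1 <= rho j + (X j.+1 - X j),
      forall j, rho j + l <= rho (j + k)%N
    & forall j, rho (j + k)%N <= rho j + (X (j + k)%N - X j) - a].
Proof.
exists rho; split=> j.
- apply/le_anti/andP; split; last exact/rho_step/reach_up.
  rewrite -lerBlDr; apply: rho_step => v h.
  by exists (v - V) => //; constructor.
- rewrite -[rho j]addr0; apply: rho_step => v h.
  have [v' h' hv'] := reach_short h j.+1; exists v' => //.
  have D0 : D j j.+1 = 0 by apply/min_idPl; rewrite subr_ge0 X_mono.
  by rewrite D0 in hv'.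
- rewrite -lerBlDr; apply: rho_step => v h.
  have [v' h' hv'] := reach_short h j; exists v' => //.
  have D0 : D j.+1 j = X j - X j.+1 by apply/min_idPr; rewrite subr_le0 X_mono.
  by rewrite D0 in hv'; lra.
- apply: rho_step => v h; exists (v + l + D (j + k) (j + k)); first exact: reach_row.
  by rewrite /D subrr minxx addr0.
suff : rho (j + k) + (a - (X (j + k)%N - X j)) <= rho j by lra.
by apply: rho_step => v h; apply: reach_back h _ _.
Qed.

End Uncrossing.

(** * Splitting a point between two consecutive slices *)

Section Slicing.
Variables (R : realType) (n k alpha : nat).
Hypotheses (n_gt0 : (0 < n)%N) (le_kn : (k <= n)%N).
Implicit Types (c : seq farc) (x : 'I_n -> R).

(** If [t <= p * b], the left side is nonpositive; if [t >= p * (b + 1)], [circuit_cover] suffices.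
    In between, [p > 0] and [b] is the floor of [t / p], so the claim is the circuit inequality
    itself. *)
Lemma circuit_slice_ineq c x (b : int) (lam : R) :
  Qpoly (Cnk R n k) (fun=> alpha) x -> \sum_j x j = b%:~R + lam -> 0 <= lam <= 1 ->
  is_circuit n k c -> ~~ has is_fshort c ->
  (winding n k c != 0 -> gamma_ineq k alpha c x) ->
  (1 - lam) * ((alpha * count is_row c)%:R - (winding n k c)%:~R * b%:~R) <=
    rshort_sum c x.
Proof.
move=> xQ sumE /andP[lam0 lam1] hc c_fs gam.
have := circuit_cover n_gt0 le_kn xQ hc c_fs.
have := rshort_sum_ge0 c xQ.1.
have {gam} := fun h => (gamma_ineqE _ alpha c x).1 (gam h); rewrite sumE [(alpha * _)%:R]pmulrn.
set p := winding n k c; set t := (alpha * _)%N%:Z; move: (rshort_sum c x) => o gam o_ge0 cover.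
have [le_t|lt_t] := lerP t (p * b).
  by apply: le_trans o_ge0; rewrite mulr_ge0_le0 ?subr_ge0 // subr_le0 -intrM ler_int.
have [ge_t|lt_t'] := lerP (p * (b + 1)) t.
  have : (p * (b + 1))%:~R <= t%:~R :> R by rewrite ler_int.
  rewrite intrM intrD => ge_tR; move: cover ge_tR.
  move: (p%:~R) (t%:~R) (b%:~R) => p' t' b' *.
  have : 0 <= lam * (t' - p' * (b' + 1)) by rewrite mulr_ge0 // subr_ge0.
  by lra.
have p_gt0 : 0 < p by nia.
move: gam; rewrite (@floor_divq_unique t p b) //; last by apply/andP; split; nia.
move=> /(_ (lt0r_neq0 p_gt0)); rewrite !(intrM, intrB, intrD).
by move: (p%:~R) (t%:~R) (b%:~R) => p' t' b' *; lra.
Qed.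

(** Charging [B / n] per unit of length turns [circuit_slice_ineq] into nonpositivity of circuit
    weights; undoing this tilt makes the potential on residues a sequence growing by [B] per
    period. *)
Lemma gamma_ineqs_potential x (b : int) (lam : R) :
  Qpoly (Cnk R n k) (fun=> alpha) x -> \sum_j x j = b%:~R + lam -> 0 <= lam <= 1 ->
  0 <= b ->
  (forall c, is_circuit n k c -> ~~ has is_fshort c -> winding n k c != 0 ->
     gamma_ineq k alpha c x) ->
  exists f : nat -> R,
    [/\ forall j, f (j + n)%N = f j + (1 - lam) * b%:~R,
        forall j, f j.+1 <= f j + ext x j
      & forall j, f j + (1 - lam) * alpha%:R <= f (j + k)%N].
Proof.
move=> xQ sumE lam01 b0 gam; have /andP[lam0 lam1] := lam01.
set a := (1 - lam) * alpha%:R; set B := (1 - lam) * b%:~R.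
have a0 : 0 <= a by rewrite mulr_ge0 ?subr_ge0.
have B0 : 0 <= B by rewrite mulr_ge0 ?subr_ge0 ?ler0z.
have n0 : n%:R != 0 :> R by rewrite pnatr_eq0 -lt0n.
pose w e := arc_weight a x e - B / n%:R * (farc_len k e)%:~R.
have w_le e : row_or_rshort n e -> w e <= a + B / n%:R.
  have Bn0 : 0 <= B / n%:R by rewrite divr_ge0.
  case: e => [i|j|j] /andP[_] //= _; rewrite /w /=.
    have : 0 <= B / n%:R * k%:R by rewrite mulr_ge0.
    by rewrite -pmulrn; lra.
  by have := ext_ge0 xQ.1 j; rewrite mulrN1z; lra.
have circ_le0 c : is_circuit n k c -> ~~ has is_fshort c -> \sum_(e <- c) w e <= 0.
  move=> hc c_fs; rewrite sumrB (sum_arc_weight _ _ hc) -mulr_sumr -rmorph_sum /=.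
  rewrite -(winding_mul n_gt0 hc).
  have := circuit_slice_ineq xQ sumE lam01 hc c_fs (gam c hc c_fs).
  rewrite natrM intrM -pmulrn => H.
  have -> : B / n%:R * ((winding n k c)%:~R * n%:R) = B * (winding n k c)%:~R by field.
  by rewrite /a /B; lra.
pose phi := potential n k w.
have phi_arc := potential_arc n_gt0 w_le circ_le0.
exists (fun j => phi (j %% n)%N + B / n%:R * j%:R); split=> j.
- by rewrite modnDr natrD; field.
- have := phi_arc (RShort (j %% n)); rewrite /row_or_rshort /= ltn_pmod // => /(_ isT).
  rewrite /w /= ext_modn -addn1 modnDml addn1 mulrN1z -[j.+1%:R]natr1; rewrite -/phi; lra.
have := phi_arc (RowArc (j %% n)); rewrite /row_or_rshort /= ltn_pmod // => /(_ isT).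
by rewrite /w /= modnDml -pmulrn natrD -/phi; lra.
Qed.

Lemma gamma_ineqs_Qstar x : Qpoly (Cnk R n k) (fun=> alpha) x ->
  (forall c, is_circuit n k c -> ~~ has is_fshort c -> winding n k c != 0 ->
     gamma_ineq k alpha c x) ->
  Qstar (Cnk R n k) (fun=> alpha) x.
Proof.
move=> xQ gam; set X := cum x; set sg := \sum_j x j.
have xE j : x j = X j.+1 - X j by rewrite /X cumS ext_ord addrAC subrr add0r.
have sg0 : 0 <= sg by apply: sumr_ge0 => j _; apply: xQ.1.
pose b := Num.floor sg; pose lam := sg - b%:~R.
have b0 : 0 <= b by rewrite floor_ge0.
have sgE : sg = b%:~R + lam by rewrite addrC subrK.
have /andP[] := floor_itv sg; rewrite -/b intrD => lam0 lam1.
have X_mono i j : (i <= j)%N -> X i <= X j by apply: cum_nondecreasing xQ.1 _ _.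
have X_win := Qpoly_cum n_gt0 le_kn xQ.
have X_period j : X (j + n)%N = X j + sg by apply: cumDn.
(* A point with integral sum already lies in an integral slice. *)
have [lamE|lam_neq0] := eqVneq lam 0.
  apply: conv_ext xE _; apply: (Qstar_increments n_gt0 le_kn (N := b)) => j //.
  - by rewrite X_period sgE lamE addr0.
  - exact: X_mono.
have lam_gt0 : 0 < lam by rewrite lt0r lam_neq0 subr_ge0.
have lam_lt1 : 0 < 1 - lam by rewrite /lam; lra.
have bR0 : 0 <= b%:~R :> R by rewrite ler0z.
have sg_gt0 : 0 < sg by lra.
have [|f [f_period f_lip f_win]] := gamma_ineqs_potential xQ sgE _ b0 gam.
  by apply/andP; split; lra.
(* With [f] as cumulative sum of [u], this is the matching candidate for [v], of total [V]. *)
pose rho0 j := X j - f j.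
pose V := lam * (b%:~R + 1).
have rho0_period j : rho0 (j + n)%N = rho0 j + V.
  by rewrite /rho0 X_period f_period sgE /V; lra.
(* [g * X + C] will serve as [U]: the slope gives period [V], [g <= 1] bounds its steps by those of
   [X], [g >= lam] gives the windows, and [C] lifts it above [rho0]. *)
pose g := V / sg.
have g0 : 0 <= g by rewrite divr_ge0 // mulr_ge0 //; lra.
have g_sg : g * sg = V by rewrite mulfVK ?gt_eqF.
have g1 : g <= 1.
  rewrite ler_pdivrMr // mul1r sgE /V -subr_ge0.
  suff : 0 <= (1 - lam) * b%:~R by lra.
  by rewrite mulr_ge0 // ltW.
have g_lam : lam <= g.
  by rewrite ler_pdivlMr // /V ler_wpM2l ?ltW // sgE; lra.
pose C := \sum_(i < n) `|rho0 i - g * X i|.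
have rho0_C j : rho0 j - g * X j <= C.
  have <- : rho0 (j %% n)%N - g * X (j %% n)%N = rho0 j - g * X j.
    apply: (periodic_modn (f := fun j => rho0 j - g * X j)) => m.
    by rewrite rho0_period X_period -g_sg; lra.
  rewrite /C (bigD1 (Ordinal (ltn_pmod j n_gt0))) //= -[leLHS]addr0 lerD ?ler_norm //.
  exact: sumr_ge0.
pose a := (1 - lam) * alpha%:R; pose l := lam * alpha%:R.
have alE : a + l = alpha%:R by rewrite /a /l; lra.
have [||||||||rho [rho_period rho_mono rho_lip rho_win rho_cowin]] :=
  @uncrossing R n k X rho0 (fun j => g * X j + C) sg V a l X_period X_mono _ rho0_period.
- by move=> j; rewrite alE.
- by move=> j; rewrite /rho0; have := f_lip j; rewrite /X cumS; lra.
- by move=> j; rewrite /rho0; have := f_win j; rewrite -/a; lra.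
- by move=> j; rewrite X_period -g_sg; lra.
- by move=> j; rewrite lerD2r ler_wpM2l // X_mono.
- move=> j; have : 0 <= (1 - g) * (X j.+1 - X j) by rewrite mulr_ge0 ?subr_ge0 ?X_mono.
  by lra.
- move=> j; have : lam * alpha%:R <= g * (X (j + k)%N - X j).
    by apply: ler_pM => //; [exact: ltW | have := X_win j; rewrite -/X; lra].
  by rewrite -/l; lra.
- by move=> j; have := rho0_C j; lra.
(* Up to constants, [X - rho] and [rho] are the cumulative sums of [u] and [v]; after rescaling, the
   totals are [b] and [b + 1]. *)
apply: (@conv_convex _ _ _ (1 - lam) lam _
  (fun j : 'I_n => (X j.+1 - rho j.+1) / (1 - lam) - (X j - rho j) / (1 - lam))
  (fun j : 'I_n => rho j.+1 / lam - rho j / lam)).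
- exact: ltW.
- exact: ltW.
- by rewrite subrK.
- apply: (Qstar_increments n_gt0 le_kn (F := fun j => (X j - rho j) / (1 - lam)) (N := b)) => j.
  + by rewrite X_period rho_period sgE /V; field; rewrite gt_eqF.
  + by rewrite ler_pM2r ?invr_gt0 //; have := rho_lip j; lra.
  rewrite -lerBrDl -mulrBl ler_pdivlMr // mulrC -/a.
  by have := rho_cowin j; lra.
- apply: (Qstar_increments n_gt0 le_kn (F := fun j => rho j / lam) (N := b + 1)) => j.
  + by rewrite rho_period /V intrD; field.
  + by rewrite ler_pM2r ?invr_gt0.
  rewrite -lerBrDl -mulrBl ler_pdivlMr // mulrC -/l.
  by have := rho_win j; lra.
by move=> j; rewrite xE; field; rewrite lam_neq0 gt_eqF.
Qed.

End Slicing.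

(** * The value of [tau] and the two inclusions *)

Theorem theorem6p4 (R : realType) (n k alpha : nat) :
  (2 <= k)%N -> (k + 2 <= n)%N -> (0 < alpha)%N ->
  exists tau : R,
    is_tau (Cnk R n k) (fun _ => alpha) tau /\
    (forall x : 'I_n -> R,
      Qstar (Cnk R n k) (fun _ => alpha) x <->
      (Qpoly (Cnk R n k) (fun _ => alpha) x /\
       tau <= \sum_j x j /\
       (forall c : seq farc, is_circuit n k c -> ~~ has is_fshort c ->
          winding n k c != 0 -> gamma_ineq k alpha c x))).
Proof.
move=> k_ge2 k_le alpha_gt0.
have n_gt0 : (0 < n)%N by lia.
have le_kn : (k <= n)%N by lia.
have k0 : 0 < k%:R :> R by rewrite ltr0n; lia.
have nR0 : 0 < n%:R :> R by rewrite ltr0n.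
(* [Qpoly_sum] bounds every sum below by [alpha * n / k]; at integral points this rounds up. *)
pose N := Num.ceil ((alpha * n)%:R / k%:R : R).
have N_ge : (alpha * n)%:R / k%:R <= N%:~R :> R by rewrite -ceil_le_int.
have N_min y : Qstar (Cnk R n k) (fun=> alpha) y -> N%:~R <= \sum_j y j.
  move=> hy; under eq_bigr do rewrite -[y _]mul1r.
  apply: conv_linear_ge hy => {}y [yQ [z yz]]; under eq_bigr do rewrite mul1r.
  have := Qpoly_sum n_gt0 le_kn yQ.
  have -> : \sum_j y j = (\sum_j z j)%:~R.
    by rewrite rmorph_sum /=; apply: eq_bigr => j _; rewrite yz.
  by rewrite ler_int ceil_le_int ler_pdivrMr // mulrC.
exists N%:~R; split.
  (* The minimum is attained at the constant vector [N / n], a point of the integral slice of sum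
     [N]. *)
  split=> //; pose F (j : nat) : R := j%:R * (N%:~R / n%:R).
  have F_period j : F (j + n)%N = F j + N%:~R.
    by rewrite /F natrD; field; rewrite gt_eqF.
  exists (increments F); split; last exact: (sum_increments n_gt0 F_period).
  have Nn0 : 0 <= N%:~R / n%:R :> R.
    by rewrite divr_ge0 // (le_trans _ N_ge) // divr_ge0.
  apply: (Qstar_increments n_gt0 le_kn F_period) => j.
    by rewrite /F ler_wpM2r // ler_nat.
  rewrite /F natrD mulrDl lerD2l mulrA ler_pdivlMr // mulrC -natrM mulnC mulrC.
  by rewrite -ler_pdivrMr.
move=> x; split=> [xQ|[xQ [_ gam]]]; last exact: gamma_ineqs_Qstar.
(* All the constraints are linear, so the hull inherits them from the integral points. *)
split; [split|split].
- move=> j; have -> : x j = \sum_i (i == j)%:R * x i.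
    rewrite (bigD1 j) //= eqxx mul1r big1 ?addr0 // => i /negPf ->; exact: mul0r.
  apply: conv_linear_ge xQ => y [[y0 _] _].
  by apply: sumr_ge0 => i _; rewrite mulr_ge0.
- by move=> i; apply: conv_linear_ge xQ => y [[_]].
- exact: N_min.
move=> c hc c_fs c_w; rewrite /gamma_ineq; apply: conv_linear_ge xQ => y [yQ y_int].
exact: gamma_ineq_integral yQ y_int hc c_fs c_w.
Qed.
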